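(* Assume $J\ge 2$. Let $f_{rec}\in\mathcal{A}$ be such that, for every $j=0,\dots,J$, the signals $f_{rec}\star\psi_j^{low}$ and $f_{rec}\star\psi_j^{high}$ have no zero entry. Let $(h_J^{low},\dots,h_0^{low},h_J^{high},\dots,h_0^{high},f)$ be a critical point of $\mathrm{obj}_2$ on the real manifold $\mathcal{C}_1\times\mathcal{A}$. Then there exist $\alpha\in\mathbb{C}\setminus\{0\}$ and $b\in\mathbb{C}$ such that $$f=\alpha f_{rec}+b,$$ where $b$ is identified with the constant signal all of whose entries equal $b$.
   Context: Signals are elements $f=(f[0],\dots,f[N-1])$ of $\mathbb{C}^N$, $N\ge1$ a fixed integer. The discrete Fourier transform is $\hat f[k]=\sum_{n=0}^{N-1}f[n]e^{-2\pi i kn/N}$, $k=0,\dots,N-1$. The circular convolution is $f\star g[k]=\sum_{n=0}^{N-1}f[n]g[k-n]$, with indices modulo $N$. Products, inverses and complex conjugates of signals are entrywise; $\|\cdot\|_2$ is the Euclidean norm on $\mathbb{C}^N$. $\mathcal{A}\subset\mathbb{C}^N$ is the set of signals $f$ with $\hat f[k]=0$ for all $N/2<k\le N-1$. Cauchy wavelets: fix $p_1,p_2>0$, $a>1$ and an integer $J$. Let $\hat\psi(x)=x^{p_1}e^{-p_2x}$ for $x\in\mathbb{R}^+=[0,\infty)$, and for $0\le j\le J$ let $\psi_j\in\mathbb{C}^N$ be defined by $\hat\psi_j[k]=\hat\psi(a^jk)$, $k=0,\dots,N-1$. Let $r=e^{-p_2\frac{a-1}{a+1}}$ and $r_j=r^{a^j}$.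 Define $\psi_j^{low},\psi_j^{high}\in\mathbb{C}^N$ by $\hat\psi_j^{low}[k]=\hat\psi_j[k]r_j^k$ and $\hat\psi_j^{high}[k]=\hat\psi_j[k]r_j^{-k}$, $k=0,\dots,N-1$. (With this choice, $\psi_{j+1}^{high}=a^{p_1}\psi_j^{low}$ for $j=0,\dots,J-1$.) Given $f_{rec}$, the set $\mathcal{C}_1\subset(\mathbb{C}^N)^{2(J+1)}$ is the set of tuples $(h_J^{low},\dots,h_0^{low},h_J^{high},\dots,h_0^{high})$ for which there is $\gamma\in(\mathbb{C}\setminus\{0\})^N$ such that, for all $j=0,\dots,J$: $h_j^{low}=\gamma\,(f_{rec}\star\psi_j^{low})$ and $h_j^{high}=\frac{1}{\overline\gamma}(f_{rec}\star\psi_j^{high})$ if $j\equiv J \pmod 2$; $h_j^{low}=\frac1{\overline\gamma}(f_{rec}\star\psi_j^{low})$ and $h_j^{high}=\gamma\,(f_{rec}\star\psi_j^{high})$ if $j\not\equiv J\pmod 2$. The function $\mathrm{obj}_2$ is $$\mathrm{obj}_2(h_J^{low},\dots,h_0^{low},h_J^{high},\dots,h_0^{high},f)=\sum_{0\le j\le J,\ j\equiv J\,[2]}\|f\star\psi_j^{low}-h_j^{low}\|_2^2+\sum_{0\le j\le J,\ j\not\equiv J\,[2]}\|f\star\psi_j^{high}-h_j^{high}\|_2^2 .$$ A critical point of $\mathrm{obj}_2$ on $\mathcal{C}_1\times\mathcal{A}$ is a point of this real manifold at which the differential of $\mathrm{obj}_2$ vanishes on the (real) tangent space of $\mathcal{C}_1\times\mathcal{A}$.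 *)

(* Defs.v *)
From HB Require Import structures.
From mathcomp Require Import all_boot all_order all_algebra.
From mathcomp Require Import all_classical all_reals all_analysis.
From mathcomp Require Import complex ring lra.

Set Implicit Arguments.
Unset Strict Implicit.
Unset Printing Implicit Defensive.

Import Order.TTheory GRing.Theory Num.Theory.
Import numFieldNormedType.Exports.

Local Open Scope classical_set_scope.
Local Open Scope ring_scope.

(* [Rcomplex R] is the field R[i] seen as a vector space over R, with the
   modulus, of type R, as norm.  We add the associated topology. *)
Section RcomplexNormedModule.
Variable R : realType.

Lemma normcZ (a : R) (z : Rcomplex R) : `|a *: z| = `|a| * `|z|.
Proof.
case: z => x y; rewrite /Num.norm /= /Normc.normc /=.
by rewrite !exprMn -mulrDr sqrtrM ?sqr_ge0 // sqrtr_sqr.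
Qed.

HB.instance Definition _ :=
  PseudoMetric.copy (Rcomplex R) (pseudoMetric_normed (Rcomplex R)).
HB.instance Definition _ := isPointed.Build (Rcomplex R) 0.
HB.instance Definition _ :=
  NormedZmod_PseudoMetric_eq.Build R (Rcomplex R) erefl.
HB.instance Definition _ :=
  PseudoMetricNormedZmod_Lmodule_isNormedModule.Build R (Rcomplex R) normcZ.

End RcomplexNormedModule.

(* The Euclidean norm on finite families of elements of a normed space; it is
   the 2-norm on signals {ffun 'I_N -> Rcomplex R}. *)
Section FfunNormedModule.
Variables (R : realType) (I : finType) (V : normedModType R).
Implicit Types f g : {ffun I -> V}.

Definition ffun_norm2 f : R := Num.sqrt (\sum_i `|f i| ^+ 2).

Lemma cauchy_schwarz_sum (u v : I -> R) :
  (\sum_i u i * v i) ^+ 2 <= (\sum_i u i ^+ 2) * (\sum_i v i ^+ 2).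
Proof.
pose A := \sum_i u i ^+ 2; pose B := \sum_i u i * v i; pose D := \sum_i v i ^+ 2.
have A0 : 0 <= A by apply: sumr_ge0 => i _; exact: sqr_ge0.
have H s t : 0 <= s ^+ 2 * A + s * t * 2 * B + t ^+ 2 * D.
  have -> : s ^+ 2 * A + s * t * 2 * B + t ^+ 2 * D =
            \sum_i (s * u i + t * v i) ^+ 2.
    rewrite /A /B /D !mulr_sumr -!big_split /=.
    by apply: eq_bigr => i _; ring.
  by apply: sumr_ge0 => i _; exact: sqr_ge0.
rewrite -/A -/B -/D.
have [A_eq0|A_neq0] := eqVneq A 0.
  have B0 : B = 0.
    rewrite /B big1 // => i _; have /eqP := A_eq0.
    rewrite psumr_eq0 => [|j _]; last exact: sqr_ge0.
    by move=> /allP /(_ i (mem_index_enum i)); rewrite sqrf_eq0 => /eqP ->;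
      rewrite mul0r.
  by rewrite B0 A_eq0 mul0r expr0n.
have A_gt0 : 0 < A by rewrite lt_def A_neq0.
have := H (- B) A.
have -> : (- B) ^+ 2 * A + - B * A * 2 * B + A ^+ 2 * D = A * (A * D - B ^+ 2).
  by ring.
by rewrite pmulr_rge0 // subr_ge0.
Qed.

Lemma sqr_ffun_norm2 f : ffun_norm2 f ^+ 2 = \sum_i `|f i| ^+ 2.
Proof. by rewrite sqr_sqrtr // sumr_ge0 // => i _; exact: sqr_ge0. Qed.

Lemma ffun_norm2D f g : ffun_norm2 (f + g) <= ffun_norm2 f + ffun_norm2 g.
Proof.
have f0 : 0 <= ffun_norm2 f by exact: sqrtr_ge0.
have g0 : 0 <= ffun_norm2 g by exact: sqrtr_ge0.
rewrite -(@ler_pXn2r _ 2) ?nnegrE ?addr_ge0 ?sqrtr_ge0 //.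
rewrite sqrrD !sqr_ffun_norm2.
have fg : \sum_i `|f i| * `|g i| <= ffun_norm2 f * ffun_norm2 g.
  rewrite -(@ler_pXn2r _ 2) ?nnegrE ?mulr_ge0 //; last first.
    by apply: sumr_ge0 => i _; rewrite mulr_ge0.
  by rewrite exprMn !sqr_ffun_norm2; exact: cauchy_schwarz_sum.
apply: (@le_trans _ _ (\sum_i (`|f i| + `|g i|) ^+ 2)).
  apply: ler_sum => i _; rewrite ffunE ler_pXn2r ?nnegrE ?addr_ge0 //.
  exact: ler_normD.
have -> : \sum_i (`|f i| + `|g i|) ^+ 2 =
    \sum_i `|f i| ^+ 2 + (\sum_i `|f i| * `|g i|) *+ 2 + \sum_i `|g i| ^+ 2.
  rewrite -sumrMnl -!big_split /=.
  by apply: eq_bigr => i _; rewrite sqrrD.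
by rewrite lerD2r lerD2l lerMn2r fg orbT.
Qed.

Lemma ffun_norm2Z (a : R) f : ffun_norm2 (a *: f) = `|a| * ffun_norm2 f.
Proof.
rewrite /ffun_norm2.
have -> : \sum_i `|(a *: f) i| ^+ 2 = `|a| ^+ 2 * \sum_i `|f i| ^+ 2.
  by rewrite mulr_sumr; apply: eq_bigr => i _; rewrite ffunE normrZ exprMn.
by rewrite sqrtrM ?sqr_ge0 // sqrtr_sqr normr_id.
Qed.

Lemma ffun_norm2_eq0 f : ffun_norm2 f = 0 -> f = 0.
Proof.
move=> f0; have : \sum_i `|f i| ^+ 2 == 0.
  by rewrite -sqr_ffun_norm2 f0 expr0n.
rewrite psumr_eq0 => [/allP fi|i _]; last exact: sqr_ge0.
apply/ffunP => i; rewrite ffunE; apply/eqP.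
by rewrite -normr_eq0 -sqrf_eq0; exact: fi (mem_index_enum i).
Qed.

HB.instance Definition _ := @Lmodule_isNormed.Build R {ffun I -> V}
  ffun_norm2 ffun_norm2D ffun_norm2Z ffun_norm2_eq0.

End FfunNormedModule.

Section CriticalPoint.
Variables (R : realType) (E : normedModType R).

(* Tangent vectors at p of a submanifold M of E: velocities at p of the
   differentiable curves drawn on M, defined near 0. *)
Definition tangent_space (M : set E) (p : E) : set E :=
  [set v | exists c : R -> E,
    [/\ \forall t \near 0, M (c t),
        \forall t \near 0, derivable c t 1,
        c 0 = p & is_derive (0 : R) 1 c v]].

(* ['d F p] is only meaningful when F is differentiable at p. *)
Definition critical_point (F : E -> R) (M : set E) (p : E) : Prop :=
  [/\ M p, differentiable F p & forall v, tangent_space M p v -> 'd F p v = 0].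

End CriticalPoint.

(* Signals of length n.+1, so that 'I_n.+1 carries the arithmetic modulo the
   length of the signal. *)
Notation signal R n := {ffun 'I_n.+1 -> Rcomplex R}.

Section Signals.
Variables (R : realType) (n : nat).
Local Notation N := n.+1.

Definition expi (t : R) : Rcomplex R := (cos t +i* sin t)%C.

Definition dft (f : signal R n) : signal R n :=
  [ffun k : 'I_N => \sum_(m < N) f m * expi (- (2 * pi * k%:R * m%:R / N%:R))].

Definition idft (g : signal R n) : signal R n :=
  [ffun m : 'I_N => N%:R^-1 *
     \sum_(k < N) g k * expi (2 * pi * k%:R * m%:R / N%:R)].

Lemma expiD s t : expi (s + t) = expi s * expi t.
Proof.
rewrite /expi cosD sinD [RHS]/GRing.mul /=; congr (_ +i* _)%C.
by rewrite addrC [cos s * _]mulrC [sin s * _]mulrC.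
Qed.

Lemma expi0 : expi 0 = 1.
Proof. by rewrite /expi cos0 sin0. Qed.

Lemma expiX t m : expi t ^+ m = expi (t * m%:R).
Proof.
elim: m => [|m IHm]; first by rewrite expr0 mulr0 expi0.
by rewrite exprS IHm -expiD -natr1 mulrDr mulr1 addrC.
Qed.

Lemma expi_2pi : expi (2 * pi) = 1.
Proof. by rewrite /expi mulr_natl cos2pi sin2pi. Qed.

Lemma expi_neq1 t : 0 < t < 2 * pi -> expi t != 1.
Proof.
move=> /andP[t0 tpi]; apply/eqP => -[ct _].
have : 0 < sin (t / 2) by apply: sin_gt0_pi; lra.
have -> : sin (t / 2) = 0; last by rewrite ltxx.
have h2 := sin2cos2 (t / 2).
have h1 := cos_mulr2n (t / 2).
have tE : (t / 2) *+ 2 = t by rewrite -mulr_natr divfK ?pnatr_eq0.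
rewrite tE ct in h1.
apply/eqP; rewrite -sqrf_eq0 h2; apply/eqP.
by rewrite mulr2n in h1; lra.
Qed.

Lemma sum_expi (k l : 'I_N) :
  \sum_(m < N) expi (2 * pi * l%:R * m%:R / N%:R) *
               expi (- (2 * pi * k%:R * m%:R / N%:R)) =
  if l == k then N%:R else 0.
Proof.
pose z := expi (2 * pi * (l%:R - k%:R) / N%:R).
have N0 : (N%:R : R) != 0 by rewrite pnatr_eq0.
transitivity (\sum_(m < N) z ^+ m).
  by apply: eq_bigr => m _; rewrite -expiD expiX; congr expi; field.
have [lk|lk] := eqVneq l k.
  rewrite /z lk subrr mulr0 mul0r expi0 (eq_bigr (fun _ => 1)) => [|m _].
    by rewrite sumr_const card_ord.
  by rewrite expr1n.
have zN : z ^+ N = 1.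
  have expi_nat m : expi (2 * pi * m%:R) = 1.
    by rewrite -expiX expi_2pi expr1n.
  rewrite expiX divfK //.
  have := expi_nat l; rewrite -[X in 2 * pi * X](subrK (k%:R)) mulrDr expiD.
  by rewrite expi_nat mulr1.
have z1 : z != 1.
  have pi0 : 0 < 2 * pi :> R by rewrite mulr_gt0 // pi_gt0.
  have key (i j : 'I_N) : (i < j)%N ->
      expi (2 * pi * (j%:R - i%:R) / N%:R) != 1.
    move=> ij; apply: expi_neq1; rewrite -natrB ?(ltnW ij) //.
    rewrite -mulrA mulr_gt0 ?divr_gt0 ?ltr0n ?subn_gt0 //=.
    rewrite -[ltRHS]mulr1 ltr_pM2l // ltr_pdivrMr ?ltr0n // mul1r ltr_nat.
    exact: leq_ltn_trans (leq_subr _ _) (ltn_ord j).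
  have [lt_lk|lt_kl|eq_lk] := ltngtP l k; last 2 first.
  - exact: key.
  - by rewrite (val_inj eq_lk) eqxx in lk.
  apply/eqP => z1; have /eqP[] := key _ _ lt_lk.
  rewrite -[LHS]mul1r -{1}z1 -expiD -[RHS]expi0; congr expi.
  by field; rewrite ?nat1r ?natr1 ?pnatr_eq0.
have /eqP := subrX1 z N.
by rewrite zN subrr eq_sym mulf_eq0 subr_eq0 (negPf z1) => /eqP.
Qed.

(* [idft] is the inverse of [dft]: prescribing the discrete Fourier transform
   of a signal is the same as applying [idft]. *)
Lemma idftK : cancel idft dft.
Proof.
move=> g; apply/ffunP => k; rewrite ffunE.
transitivity (\sum_(l < N) N%:R^-1 * g l *
    \sum_(m < N) expi (2 * pi * l%:R * m%:R / N%:R) *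
                 expi (- (2 * pi * k%:R * m%:R / N%:R))).
  under eq_bigr => m _ do rewrite ffunE mulr_sumr mulr_suml.
  rewrite exchange_big /=; apply: eq_bigr => l _; rewrite mulr_sumr.
  by apply: eq_bigr => m _; rewrite !mulrA.
rewrite (bigD1 k) //= sum_expi eqxx big1 => [|l lk].
  have N0 : (N%:R : Rcomplex R) != 0.
    by rewrite (pnatr_eq0 R[i]).
  by rewrite addr0 mulrAC mulVf // mul1r.
by rewrite sum_expi (negPf lk) mulr0.
Qed.

(* k - m is the subtraction of 'I_N, i.e. modulo N. *)
Definition circ_conv (f g : signal R n) : signal R n :=
  [ffun k : 'I_N => \sum_(m < N) f m * g (k - m)].

Definition analytic_signals : set (signal R n) :=
  [set f | forall k : 'I_N, (N < 2 * k)%N -> dft f k = 0].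

End Signals.

Section Wavelets.
Variables (R : realType) (n : nat) (p1 p2 a : R).
Local Notation N := n.+1.

(* The Cauchy wavelet profile, used for x >= 0; psi_hat 0 = 0 as p1 > 0. *)
Definition psi_hat (x : R) : R := x `^ p1 * expR (- p2 * x).

Definition ratio : R := expR (- p2 * ((a - 1) / (a + 1))).

Definition ratio_at (j : nat) : R := ratio `^ (a ^+ j).

Definition psi_low (j : nat) : signal R n :=
  idft [ffun k : 'I_N => (psi_hat (a ^+ j * k%:R) * ratio_at j ^+ k)%:C%C].

Definition psi_high (j : nat) : signal R n :=
  idft [ffun k : 'I_N => (psi_hat (a ^+ j * k%:R) * ratio_at j ^- k)%:C%C].

End Wavelets.

Section Objective.
Variables (R : realType) (n : nat) (p1 p2 a : R) (J : nat).
Local Notation N := n.+1.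
Local Notation sig := (signal R n).
Local Notation low j := (psi_low n p1 p2 a j).
Local Notation high j := (psi_high n p1 p2 a j).

(* The tuple (h_J^low, ..., h_0^low, h_J^high, ..., h_0^high), as the pair of
   the families of the h_j^low and of the h_j^high. *)
Local Notation tuples := ({ffun 'I_J.+1 -> sig} * {ffun 'I_J.+1 -> sig})%type.

Definition C1 (f_rec : sig) : set tuples :=
  [set h : tuples | exists gamma : sig, (forall k : 'I_N, gamma k != 0) /\
    forall (j : 'I_J.+1) (k : 'I_N),
      if j == J %[mod 2]
      then h.1 j k = gamma k * circ_conv f_rec (low j) k /\
           h.2 j k = (conjc (gamma k) : Rcomplex R)^-1 * circ_conv f_rec (high j) k
      else h.1 j k = (conjc (gamma k) : Rcomplex R)^-1 * circ_conv f_rec (low j) k /\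
           h.2 j k = gamma k * circ_conv f_rec (high j) k].

Definition obj2 (x : tuples * sig) : R :=
  \sum_(j < J.+1 | j == J %[mod 2]) `|circ_conv x.2 (low j) - x.1.1 j| ^+ 2 +
  \sum_(j < J.+1 | j != J %[mod 2]) `|circ_conv x.2 (high j) - x.1.2 j| ^+ 2.

End Objective.

Section ObjectiveDifferentiable.
Variables (R : realType) (n : nat) (p1 p2 a : R) (J : nat).
Local Notation N := n.+1.
Local Notation sig := (signal R n).
Local Notation point :=
  ({ffun 'I_J.+1 -> sig} * {ffun 'I_J.+1 -> sig} * sig)%type.

Lemma le_norm_ffun (I : finType) (V : normedModType R) (g : {ffun I -> V}) i :
  `|g i| <= `|g|.
Proof.
have g0 : 0 <= `|g| by [].
rewrite -(@ler_pXn2r _ 2) ?nnegrE //.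
have -> : `|g| ^+ 2 = \sum_j `|g j| ^+ 2 by exact: sqr_ffun_norm2.
by rewrite (bigD1 i) //= lerDl sumr_ge0 // => j _; exact: sqr_ge0.
Qed.

Lemma bounded_linear_differentiable (V W : normedModType R) (g : V -> W)
    (r : R) (x : V) :
  linear g -> (forall y, `|g y| <= r * `|y|) -> differentiable g x.
Proof.
move=> lg gr.
pose gL := GRing.isLinear.Build R V W *:%R g lg.
pose gl : {linear V -> W} := HB.pack g gL.
apply: (@linear_differentiable _ _ _ gl).
apply/linear_bounded_continuous/linear_boundedP.
near=> s => y; apply: le_trans (gr y) _.
by rewrite ler_wpM2r //; near: s; exact: nbhs_pinfty_ge (num_real r).
Unshelve. all: by end_near. Qed.

Lemma differentiable_sumP (V : normedModType R) (I : finType) (P : pred I)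
    (g : I -> V -> R) (x : V) :
  (forall i, differentiable (g i) x) ->
  differentiable (fun y => \sum_(i | P i) g i y) x.
Proof.
move=> dg; elim: (index_enum I) => [|i s IHs].
  have -> : (fun y => \sum_(i <- [::] | P i) g i y) = cst 0.
    by apply/funext => y; rewrite big_nil.
  exact: differentiable_cst.
case Pi: (P i); last first.
  have -> // : (fun y => \sum_(j <- i :: s | P j) g j y) =
      (fun y => \sum_(j <- s | P j) g j y).
  by apply/funext => y; rewrite big_cons Pi.
have -> : (fun y => \sum_(j <- i :: s | P j) g j y) =
    g i + (fun y => \sum_(j <- s | P j) g j y).
  by apply/funext => y; rewrite big_cons Pi.
exact: differentiableD.
Qed.

Lemma differentiable_sqnorm_linear (V : normedModType R) (g : V -> sig)
    (r : R) (x : V) :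
  linear g -> (forall y k, `|g y k| <= r * `|y|) ->
  differentiable (fun y => `|g y| ^+ 2) x.
Proof.
move=> lg gr.
have -> : (fun y => `|g y| ^+ 2) =
    (fun y => \sum_k (complex.Re (g y k) ^+ 2 + complex.Im (g y k) ^+ 2)).
  apply/funext => y; rewrite [LHS]sqr_ffun_norm2; apply: eq_bigr => k _.
  case: (g y k) => u v; rewrite [`|_|]/Num.norm /= sqr_sqrtr //.
  by rewrite addr_ge0 ?sqr_ge0.
apply: differentiable_sumP => k.
have dRe : differentiable (fun y => complex.Re (g y k)) x.
  apply: (@bounded_linear_differentiable _ _ _ r) => [s u v|y].
    by rewrite lg !ffunE; case: (g u k) (g v k) => ? ? [].
  apply: le_trans (gr y k); case: (g y k) => u v.
  by rewrite [leRHS]/Num.norm /= -sqrtr_sqr ler_sqrt ?lerDl ?addr_ge0 ?sqr_ge0.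
have dIm : differentiable (fun y => complex.Im (g y k)) x.
  apply: (@bounded_linear_differentiable _ _ _ r) => [s u v|y].
    by rewrite lg !ffunE; case: (g u k) (g v k) => ? ? [].
  apply: le_trans (gr y k); case: (g y k) => u v.
  by rewrite [leRHS]/Num.norm /= -sqrtr_sqr ler_sqrt ?lerDr ?addr_ge0 ?sqr_ge0.
have -> : (fun y => complex.Re (g y k) ^+ 2 + complex.Im (g y k) ^+ 2) =
    (fun y => complex.Re (g y k)) ^+ 2 + (fun y => complex.Im (g y k)) ^+ 2.
  by apply/funext => y; rewrite !expr2.
exact: differentiableD (differentiableX _ dRe) (differentiableX _ dIm).
Qed.

Lemma circ_conv_linear (psi : sig) : linear (fun f : sig => circ_conv f psi).
Proof.
move=> s u v; apply/ffunP => k; rewrite !ffunE scaler_sumr -big_split /=.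
by apply: eq_bigr => m _; rewrite !ffunE mulrDl scalerAl.
Qed.

Lemma le_norm_circ_conv (f psi : sig) k :
  `|circ_conv f psi k| <= N%:R * `|psi| * `|f|.
Proof.
rewrite ffunE (le_trans (ler_norm_sum _ _ _)) //.
have -> : N%:R * `|psi| * `|f| = \sum_(m < N) `|f| * `|psi|.
  by rewrite sumr_const card_ord -mulr_natl; ring.
apply: ler_sum => m _.
rewrite [leLHS](Normc.normcM (f m) (psi (k - m))).
have ge0 (z : Rcomplex R) : 0 <= Normc.normc z by case: z => u v; exact: sqrtr_ge0.
apply: ler_pM; [exact: ge0 | exact: ge0 | |].
  exact: (@le_norm_ffun _ (Rcomplex R) f m).
exact: (@le_norm_ffun _ (Rcomplex R) psi (k - m)).
Qed.

(* Hence the differentiability required by [critical_point] is automatic for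
   [obj2]. *)
Lemma differentiable_obj2 (x : point) : differentiable (@obj2 R n p1 p2 a J) x.
Proof.
have d (b : bool) (psi : sig) (j : 'I_J.+1) : differentiable (fun y : point =>
    `|circ_conv y.2 psi - (if b then y.1.1 j else y.1.2 j)| ^+ 2) x.
  apply: (@differentiable_sqnorm_linear _ _ (N%:R * `|psi| + 1)).
    move=> s u v; rewrite circ_conv_linear; case: b => /=;
      by rewrite !ffunE scalerBr opprD addrACA.
  move=> y k; rewrite [_ k]ffunE [X in _ + X]ffunE.
  rewrite (le_trans (ler_normB _ _)) // mulrDl mul1r lerD //.
    apply: le_trans (le_norm_circ_conv _ _ _) _.
    by rewrite ler_wpM2l ?mulr_ge0 // prod_normE le_max lexx orbT.
  rewrite prod_normE le_max prod_normE le_max; apply/orP; left; apply/orP.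
  case: b; [left | right].
    exact: le_trans (le_norm_ffun (y.1.1 j) k) (le_norm_ffun y.1.1 j).
  exact: le_trans (le_norm_ffun (y.1.2 j) k) (le_norm_ffun y.1.2 j).
apply: (@differentiableD _ _ _
    (fun y : point => \sum_(j < J.+1 | j == J %[mod 2])
       `|circ_conv y.2 (psi_low n p1 p2 a j) - y.1.1 j| ^+ 2)
    (fun y : point => \sum_(j < J.+1 | j != J %[mod 2])
       `|circ_conv y.2 (psi_high n p1 p2 a j) - y.1.2 j| ^+ 2));
  apply: differentiable_sumP => j.
  exact: (d true).
exact: (d false).
Qed.

End ObjectiveDifferentiable.

(* Main.v *)
Require Import Defs.
From mathcomp Require Import all_boot all_order all_algebra.
From mathcomp Require Import all_classical all_reals all_analysis.
From mathcomp Require Import complex ring lra.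
Import Order.TTheory GRing.Theory Num.Theory.
Import numFieldNormedType.Exports.
Local Open Scope classical_set_scope.
Local Open Scope ring_scope.

Set Implicit Arguments.
Unset Strict Implicit.
Unset Printing Implicit Defensive.

(** The objective only involves the components of the tuple that are multiplied
    by [gamma], and is a homogeneous quadratic form in [(gamma, f)].  The curve
    [t |-> ((1 + t) * gamma, (1 + t) * f)] stays on the manifold, so at a critical
    point Euler's identity forces the objective to vanish: in particular
    [f * psi_j^low = gamma (f_rec * psi_j^low)] for [j = J] and [j = J - 2].
    Up to a constant, [(g * psi_j^low)[m]] is the value at [s_j e^(2 i pi m / N)]
    of the polynomial [\sum_k k^p1 dft g [k] z^k], so the polynomials [P], [Q] of
    [f], [f_rec] satisfy [P(s z) Q(t z) = P(t z) Q(s z)], with [s = s_J] and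
    [t = s_(J-2)], at the [N]-th roots of unity.  By analyticity both sides have
    degree at most [N] and are divisible by [z^2], so this is a polynomial
    identity.  Subtract from [P] the multiple of [Q] that cancels its coefficient
    of degree [deg Q]: comparing leading coefficients, the rest must vanish, since
    [s^i t^j = s^j t^i] only for [i = j].  Hence [P = alpha Q], that is
    [dft f = alpha dft f_rec] away from the frequency [0]. *)

(** * Polynomials compared along two dilations *)

Lemma poly_dilation_rigidity (F : fieldType) (s t : F) (p q : {poly F}) :
  s != 0 -> t != 0 -> (forall i j : nat, s ^+ i * t ^+ j = s ^+ j * t ^+ i -> i = j) ->
  q != 0 ->
  (p \Po (s *: 'X)) * (q \Po (t *: 'X)) = (p \Po (t *: 'X)) * (q \Po (s *: 'X)) ->
  exists alpha, p = alpha *: q.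
Proof.
move=> s0 t0 st q0 pq; pose d := (size q).-1.
pose alpha := p`_d / lead_coef q; exists alpha.
apply/eqP; rewrite -subr_eq0; apply/negPn/negP => r0.
set r := p - alpha *: q in r0.
(* The relation is linear in [p] and trivial for [q] in place of [p], so [r] inherits it. *)
have rq : (r \Po (s *: 'X)) * (q \Po (t *: 'X)) =
    (r \Po (t *: 'X)) * (q \Po (s *: 'X)).
  rewrite /r !comp_polyB !comp_polyZ !mulrBl pq -!scalerAl.
  by rewrite [X in _ - alpha *: X]mulrC.
have rd : r`_d = 0.
  by rewrite /r coefB coefZ /alpha -lead_coefE divfK ?subrr // lead_coef_eq0.
have szX (c : F) : c != 0 -> size (c *: 'X : {poly F}) = 2%N.
  by move=> c0; rewrite size_scale // size_polyX.
have lcX (c : F) : lead_coef (c *: 'X : {poly F}) = c.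
  by rewrite lead_coefZ lead_coefX mulr1.
have /(congr1 lead_coef) := rq.
rewrite !lead_coefM !lead_coef_comp ?szX // !lcX => E.
have /eqP := rd; apply/negP.
suff -> : d = (size r).-1 by rewrite -lead_coefE lead_coef_eq0.
apply/esym/st; apply: (@mulfI _ (lead_coef r * lead_coef q)).
  by rewrite mulf_neq0 ?lead_coef_eq0.
by rewrite mulrACA E mulrACA; congr (_ * _); exact: mulrC.
Qed.

(** The degree of each product may equal the number of points, one too many for a root count.
    Dividing [p] and [q] by ['X] lowers it enough: the difference of the two sides then has too many
    roots. *)
Lemma poly_dilation_rigidity_sampled (F : fieldType) (s t : F)
    (zs : seq F) (p q : {poly F}) :
  s != 0 -> t != 0 -> (forall i j : nat, s ^+ i * t ^+ j = s ^+ j * t ^+ i -> i = j) ->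
  uniq zs -> 0 \notin zs -> p`_0 = 0 -> q`_0 = 0 -> q != 0 ->
  ((size p).-1 + (size q).-1 <= size zs)%N ->
  (forall z, z \in zs -> p.[s * z] * q.[t * z] = p.[t * z] * q.[s * z]) ->
  exists alpha, p = alpha *: q.
Proof.
move=> s0 t0 st zs_uniq zs0 p0 q0 qn0 spq pq.
have dropE (r : {poly F}) : r`_0 = 0 -> r = drop_poly 1 r * 'X.
  move=> r0; rewrite -{1}[r](poly_take_drop 1) expr1 [X in X + _](_ : _ = 0) ?add0r //.
  by apply/polyP => -[|i]; rewrite coef_take_poly coef0.
have [P pE sP] : exists2 P, p = P * 'X & size P = (size p).-1.
  by exists (drop_poly 1 p); [exact: dropE | rewrite size_drop_poly subn1].
have [Q qE sQ] : exists2 Q, q = Q * 'X & size Q = (size q).-1.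
  by exists (drop_poly 1 q); [exact: dropE | rewrite size_drop_poly subn1].
have Qn0 : Q != 0 by apply: contraNneq qn0 => Q0; rewrite qE Q0 mul0r.
suff [alpha PQ] : exists alpha, P = alpha *: Q.
  by exists alpha; rewrite pE qE PQ scalerAl.
apply: (@poly_dilation_rigidity _ s t) => //.
have szX (c : F) : c != 0 -> size (c *: 'X : {poly F}) = 2%N.
  by move=> c0; rewrite size_scale // size_polyX.
apply/eqP; rewrite -subr_eq0; apply/negPn/negP => D0.
have := max_poly_roots D0 _ zs_uniq.
rewrite ltnNge; move=> /(_ _)/negP[].
  apply/allP => z z_zs; have z0 : z != 0 by apply: contraNneq zs0 => <-.
  rewrite rootE hornerD hornerN !hornerM !horner_comp !hornerZ hornerX subr_eq0.
  have stz : s * z * (t * z) != 0 by rewrite !mulf_neq0.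
  apply/eqP/(mulIf stz); rewrite mulrACA.
  have := pq z z_zs; rewrite pE qE !hornerM !hornerX => E.
  by rewrite E mulrACA [t * z * _]mulrC.
apply: leq_trans (size_polyD _ _) _; rewrite size_polyN geq_max.
suff bnd (u v : F) : u != 0 -> v != 0 ->
    (size ((P \Po (u *: 'X)) * (Q \Po (v *: 'X)))%R <= size zs)%N by rewrite !bnd.
move=> u0 v0; apply: leq_trans (size_polyMleq _ _) _.
rewrite !size_comp_poly2 ?szX // sP sQ.
exact: leq_trans (leq_pred _) spq.
Qed.

(** The equation reads [(s / t) ^+ i = (s / t) ^+ j], with [0 < s / t < 1]. *)
Lemma exprM_swap_inj (F : realFieldType) (s t : F) (i j : nat) : 0 < s -> s < t ->
  s ^+ i * t ^+ j = s ^+ j * t ^+ i -> i = j.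
Proof.
move=> s0 st E; have t0 : 0 < t := lt_trans s0 st.
have q0 : 0 < s / t by rewrite divr_gt0.
apply: (ieexprIn q0); first by rewrite lt_eqF // ltr_pdivrMr // mul1r.
rewrite !expr_div_n; apply/eqP; rewrite eqr_div ?expf_neq0 ?lt0r_neq0 //.
exact/eqP.
Qed.

(** * Roots of unity, Fourier inversion and convolution *)

Lemma expi_neq0 (R : realType) (x : R) : expi x != 0.
Proof.
apply/eqP => x0; have := expiD x (- x); rewrite x0 mul0r subrr expi0 => /eqP.
by rewrite oner_eq0.
Qed.

Lemma expi_2pi_nat (R : realType) (m : nat) : expi (2 * pi * m%:R : R) = 1.
Proof. by rewrite -expiX expi_2pi expr1n. Qed.

Lemma expi_2pi_modn (R : realType) (N l m : nat) : (0 < N)%N ->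
  expi (2 * pi * l%:R * (m %% N)%:R / N%:R : R) = expi (2 * pi * l%:R * m%:R / N%:R).
Proof.
move=> N0; have Nn0 : (N%:R : R) != 0 by rewrite pnatr_eq0 -lt0n.
rewrite {2}(divn_eq m N) natrD natrM.
rewrite [X in _ = expi X](_ : _ = 2 * pi * (l * (m %/ N))%:R
  + 2 * pi * l%:R * (m %% N)%:R / N%:R); last by rewrite natrM; field.
by rewrite expiD expi_2pi_nat mul1r.
Qed.

Lemma dftK (R : realType) (n : nat) : cancel (@dft R n) (@idft R n).
Proof.
move=> f; apply/ffunP => m; rewrite ffunE.
transitivity (n.+1%:R^-1 * \sum_(l < n.+1) f l *
    \sum_(k < n.+1) expi (2 * pi * m%:R * k%:R / n.+1%:R) *
      expi (- (2 * pi * l%:R * k%:R / n.+1%:R))).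
  congr (_ * _); under eq_bigr => k _ do rewrite ffunE mulr_suml.
  rewrite exchange_big /=; apply: eq_bigr => l _; rewrite mulr_sumr.
  apply: eq_bigr => k _; rewrite -mulrA [X in _ * X]mulrC.
  by congr (_ * (expi _ * expi _)); ring.
rewrite (bigD1 m) //= sum_expi eqxx big1 => [|l lm]; last first.
  by rewrite sum_expi eq_sym (negPf lm) mulr0.
have N0 : (n.+1%:R : Rcomplex R) != 0 by rewrite (pnatr_eq0 R[i]).
by rewrite addr0 mulrCA mulVf // mulr1.
Qed.

Lemma circ_conv_idft (R : realType) (n : nat) (f g : signal R n) :
  circ_conv f (idft g) = idft [ffun l => dft f l * g l].
Proof.
apply/ffunP => k; rewrite !ffunE.
under eq_bigr => m _ do rewrite ffunE mulrCA mulr_sumr.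
rewrite -mulr_sumr exchange_big /=; congr (_ * _); apply: eq_bigr => l _.
rewrite !ffunE -[RHS]mulrA mulr_suml; apply: eq_bigr => m _.
rewrite -[RHS]mulrA; congr (_ * _); rewrite [RHS]mulrCA; congr (_ * _).
(* In ['I_n.+1], [k - m] unfolds to [(k + (n.+1 - m) %% n.+1) %% n.+1]; periodicity removes the
   outer reduction here and the inner one next. *)
rewrite /= expi_2pi_modn // -expiD.
suff -> : expi (2 * pi * l%:R * (k + (n.+1 - m) %% n.+1)%:R / n.+1%:R : R) =
  expi (2 * pi * l%:R * (k + (n.+1 - m))%:R / n.+1%:R).
  rewrite natrD natrB ?(ltnW (ltn_ord m)) //.
  rewrite [X in expi X = _](_ : _ = 2 * pi * l%:R + (- (2 * pi * l%:R * m%:R / n.+1%:R) +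
    2 * pi * l%:R * k%:R / n.+1%:R));
    last by field; rewrite ?nat1r pnatr_eq0.
  by rewrite [LHS]expiD expi_2pi_nat mul1r.
by rewrite -expi_2pi_modn // modnDmr expi_2pi_modn.
Qed.

(** If two of these roots coincided, every term of their orthogonality sum would be 1, and the sum
    could not vanish. *)
Lemma expi_2pi_inj (R : realType) (n : nat) :
  injective (fun m : 'I_n.+1 => expi (2 * pi * m%:R / n.+1%:R : R)).
Proof.
move=> l k /= lk; apply/eqP/negPn/negP => /negPf lk'.
have := sum_expi R l k; rewrite eq_sym lk' => /eqP; apply/negP.
rewrite (eq_bigr (fun=> 1)) => [|m _].
  by rewrite sumr_const card_ord (pnatr_eq0 R[i]).
have expi_pow (i : 'I_n.+1) : expi (2 * pi * i%:R * m%:R / n.+1%:R : R) =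
    expi (2 * pi * i%:R / n.+1%:R) ^+ m by rewrite expiX mulrAC.
by rewrite expi_pow -lk -expi_pow -expiD subrr expi0.
Qed.

(** * Euler's identity at a critical point *)

Lemma is_derive_scaler_const (R : realType) (E : normedModType R) (g : R -> R)
    (x dg : R) (v : E) :
  is_derive x 1 g dg -> is_derive x 1 (fun t => g t *: v) (dg *: v).
Proof.
move=> [dv Dg].
have dgx : differentiable (g : R^o -> R^o) x by exact/derivable1_diffP.
have ds := is_diff_scalel (g x : R^o) v.
have := is_diff_comp (differentiableP dgx) ds.
move=> [dc Dc]; apply: DeriveDef; first exact: diff_derivable.
by rewrite deriveE // Dc /= -deriveE // Dg.
Qed.

(** The curve in [M] has velocity [u - w] at 0. The derivative of [F] in that direction can be
    computed on the straight line instead, where it is [2 * F (u + w)]. *)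
Lemma critical_point_quadratic (R : realType) (E : normedModType R)
    (F : E -> R) (M : set E) (u w : E) :
  critical_point F M (u + w) ->
  (forall t : R, -1 < t -> M ((1 + t) *: u + (1 + t)^-1 *: w)) ->
  (forall t : R, F (t *: (u - w) + (u + w)) = (1 + t) ^+ 2 * F (u + w)) ->
  F (u + w) = 0.
Proof.
move=> [Mp dF crit] Mc Fc.
have Dc (t : R) : -1 < t ->
    is_derive (t : R^o) 1 (fun t : R => (1 + t) *: u + (1 + t)^-1 *: w)
    (u - (1 + t) ^- 2 *: w).
  move=> t1; have t0 : 1 + t != 0 by rewrite gt_eqF //; lra.
  have D1 : is_derive (t : R^o) 1 (fun t : R => 1 + t : R) 1.
    by rewrite -[X in is_derive _ _ _ X]add0r; apply: is_deriveD.
  rewrite -[u in u - _]scale1r -scaleNr; apply: is_deriveD.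
    exact: is_derive_scaler_const.
  apply: is_derive_scaler_const.
  by rewrite -[X in is_derive _ _ _ X]mulr1; apply: is_deriveV.
have := crit (u - w); rewrite -deriveE // => /(_ _).
have -> : 'D_(u - w) F (u + w) = 2 * F (u + w).
  rewrite /derive; apply: cvg_lim => //.
  (* The difference quotient is exactly this, as [(1 + h) ^+ 2 - 1 = h * (2 + h)]. *)
  have : ((2 + h) * F (u + w)) @[h --> (0 : R)^'] --> (2 + 0) * F (u + w).
    by apply: cvgM; [apply: cvgD; [exact: cvg_cst | exact: cvg_within] | exact: cvg_cst].
  rewrite addr0; apply: cvg_trans; apply: near_eq_cvg; near=> h.
  have h0 : h != 0 by near: h; exact: nbhs_dnbhs_neq.
  by rewrite /= Fc /GRing.scale /=; field.
move=> H; apply/eqP; move: H => /(_ _)/eqP; rewrite mulf_eq0 pnatr_eq0 /=; apply.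
have oneN1 : -1 < 0 :> R by rewrite ltrN10.
have near1 : \forall t \near (0 : R), -1 < t by exact: lt_nbhsr.
exists (fun t : R => (1 + t) *: u + (1 + t)^-1 *: w); split.
- by near=> t; apply: Mc; near: t.
- by near=> t; have /Dc[] // : -1 < t by near: t.
- by rewrite addr0 invr1 !scale1r.
- by have := Dc 0 oneN1; rewrite addr0 expr1n invr1 scale1r.
Unshelve. all: end_near.
Qed.

(** * Compatibility with real scalings *)

Lemma scale_RcomplexE (R : realType) (c : R) (z : Rcomplex R) :
  c *: z = (c%:C%C : Rcomplex R) * z.
Proof.
case: z => x y; rewrite /GRing.scale /= [RHS]/GRing.mul /=.
by rewrite !mul0r subr0 addr0.
Qed.

Lemma inv_conjc_scale (R : realType) (c : R) (z : Rcomplex R) :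
  (conjc (c *: z) : Rcomplex R)^-1 = c^-1 *: (conjc z : Rcomplex R)^-1.
Proof.
have -> : conjc (c *: z) = c *: (conjc z : Rcomplex R) :> Rcomplex R.
  by case: z => x y; rewrite /GRing.scale /= mulrN.
by rewrite !scale_RcomplexE invfM; congr (_ * _); exact/esym/(fmorphV (@real_complex R)).
Qed.

Lemma circ_convZ (R : realType) (n : nat) (c : R) (f g : signal R n) :
  circ_conv (c *: f) g = c *: circ_conv f g.
Proof.
apply/ffunP => k; rewrite !ffunE scaler_sumr; apply: eq_bigr => m _.
by rewrite ffunE scalerAl.
Qed.

(** * Wavelet convolutions as values of a polynomial *)

Section CauchyPolynomial.
Variables (R : realType) (n : nat) (p1 p2 a : R).

(** The weight [k^p1] is the part of the wavelet profile common to all scales, up to a constant; the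
    rest of the scale dependence goes into the evaluation point. *)
Definition cauchy_poly (f : signal R n) : {poly Rcomplex R} :=
  \poly_(k < n.+1) (dft f (inord k) * (k%:R `^ p1)%:C%C).

Definition low_decay (j : nat) : R := expR (- p2 * a ^+ j) * ratio_at p2 a j.

Lemma circ_conv_psi_low (f : signal R n) (j : nat) (m : 'I_n.+1) : 0 < a ->
  circ_conv f (psi_low n p1 p2 a j) m =
  (n.+1%:R^-1 * ((a ^+ j) `^ p1)%:C%C) *
  (cauchy_poly f).[(low_decay j)%:C%C * expi (2 * pi * m%:R / n.+1%:R)].
Proof.
move=> a0; rewrite /psi_low circ_conv_idft ffunE -mulrA; congr (_ * _).
rewrite horner_poly mulr_sumr; apply: eq_bigr => k _.
rewrite !ffunE inord_val exprMn expiX.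
have -> : 2 * pi * m%:R / n.+1%:R * k%:R = 2 * pi * k%:R * m%:R / n.+1%:R :> R by ring.
have -> : psi_hat p1 p2 (a ^+ j * k%:R) * ratio_at p2 a j ^+ k =
    (a ^+ j) `^ p1 * k%:R `^ p1 * low_decay j ^+ k.
  rewrite /psi_hat powRM ?ler0n ?exprn_ge0 ?(ltW a0) //.
  have -> : expR (- p2 * (a ^+ j * k%:R)) = expR (- p2 * a ^+ j) ^+ k.
    by rewrite mulrA expRM_natr.
  by rewrite /low_decay exprMn; ring.
have rc (x y z : R) : ((x * y * z ^+ k)%:C%C : Rcomplex R) =
    (x%:C%C : Rcomplex R) * (y%:C%C : Rcomplex R) * (z%:C%C : Rcomplex R) ^+ k.
  by rewrite (rmorphM (@real_complex R)) (rmorphM (@real_complex R)) (rmorphXn (@real_complex R)).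
by rewrite rc; ring.
Qed.

Lemma low_decay_gt0 j : 0 < low_decay j.
Proof. by rewrite mulr_gt0 ?expR_gt0 // powR_gt0 // expR_gt0. Qed.

(** The decay at [j] is the exponential of [- p2 * (1 + c) * a ^+ j], with [c = (a - 1) / (a + 1)]
    nonnegative. *)
Lemma low_decay_decreasing (i j : nat) : 0 < p2 -> 1 < a -> (i < j)%N ->
  low_decay j < low_decay i.
Proof.
move=> p20 a1 ij.
have aij : a ^+ i < a ^+ j by rewrite ltr_eXn2l.
rewrite /low_decay /ratio_at /Defs.ratio -!expRM -!expRD ltr_expR.
set c := (a - 1) / (a + 1).
have c0 : 0 <= c by rewrite divr_ge0 //; lra.
clearbody c.
rewrite -!mulrA -!mulrDr !mulNr ltrN2 ltr_pM2l //.
by apply: ltr_leD => //; rewrite ler_wpM2l // ltW.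
Qed.

Lemma cauchy_poly_coef0 f : p1 != 0 -> (cauchy_poly f)`_0 = 0.
Proof. by move=> p10; rewrite coef_poly /= powR0 // mulr0. Qed.

Lemma size_cauchy_poly f : analytic_signals f ->
  (size (cauchy_poly f) <= n.+1./2.+1)%N.
Proof.
move=> fA; apply/leq_sizeP => k hk; rewrite coef_poly; case: ifP => // kn.
rewrite fA ?mul0r // inordK //= mul2n -ltn_half_double.
exact: hk.
Qed.

(** The weight [k^p1] is nonzero for [k > 0], so only the frequency 0 is left free, and a
    discrepancy there is a constant signal. *)
Lemma eq_cauchy_poly f g (c : Rcomplex R) :
  cauchy_poly f = c *: cauchy_poly g ->
  exists b, forall k : 'I_n.+1, f k = c * g k + b.
Proof.
move=> fg.
have fgk (k : 'I_n.+1) : k != ord0 -> dft f k = c * dft g k.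
  move=> k0; have := congr1 (fun p : {poly Rcomplex R} => p`_k) fg.
  rewrite /= coefZ !coef_poly ltn_ord inord_val mulrA; apply: mulIf.
  rewrite (fmorph_eq0 (@real_complex R)) gt_eqF // powR_gt0 // ltr0n lt0n.
  exact: k0.
exists (n.+1%:R^-1 * (dft f ord0 - c * dft g ord0)) => k.
rewrite -[f]dftK -[g]dftK ffunE [in RHS]ffunE mulrCA -mulrDr; congr (_ * _).
rewrite !big_ord_recl !mulr0 !mul0r expi0 !dftK.
set u := \sum_(i < n) _; set v := \sum_(i < n) _.
have -> : u = c * v.
  by rewrite mulr_sumr; apply: eq_bigr => i _; rewrite fgk // mulrA.
by ring.
Qed.

End CauchyPolynomial.

(** * Homogeneity of the objective and its vanishing at critical points *)

Section Objective.
Variables (R : realType) (n : nat) (p1 p2 a : R) (J : nat).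
Local Notation sig := (signal R n).
Local Notation tuples := ({ffun 'I_J.+1 -> sig} * {ffun 'I_J.+1 -> sig})%type.

(* The other components carry the factor 1 / conj gamma, so that replacing gamma
   by c * gamma, c real, multiplies them by c^-1. *)
Definition gamma_part (h : tuples) : tuples :=
  ([ffun j : 'I_J.+1 => if j == J %[mod 2] then h.1 j else 0],
   [ffun j : 'I_J.+1 => if j == J %[mod 2] then 0 else h.2 j]).

Lemma C1_scale (f_rec : sig) (h : tuples) (c : R) : c != 0 ->
  C1 p1 p2 a f_rec h ->
  C1 p1 p2 a f_rec (c *: gamma_part h + c^-1 *: (h - gamma_part h)).
Proof.
move=> c0 [gamma [gamma0 hg]]; exists (c *: gamma); split=> [k|j k].
  by rewrite ffunE scaler_eq0 negb_or c0 gamma0.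
have := hg j k; rewrite !ffunE /=; case: ifP => _ [E1 E2];
  by rewrite !ffunE E1 E2 inv_conjc_scale !subrr ?subr0 !scaler0 ?add0r ?addr0
    !scalerAl.
Qed.

(** The objective reads only the components kept by [gamma_part], so [w] is invisible to it. *)
Lemma obj2_scale (h : tuples) (f : sig) (t : R) :
  let u := (gamma_part h, f) in let w := (h - gamma_part h, 0) in
  obj2 p1 p2 a (t *: (u - w) + (u + w)) = (1 + t) ^+ 2 * obj2 p1 p2 a (h, f).
Proof.
move=> u w; set x := t *: (u - w) + (u + w).
have scaleE (V : lmodType R) (v : V) : t *: v + v = (1 + t) *: v.
  by rewrite scalerDl scale1r addrC.
have xf : x.2 = (1 + t) *: f by rewrite -scaleE /x /= subr0 addr0.
have xlow (j : 'I_J.+1) : j == J %[mod 2] -> x.1.1 j = (1 + t) *: h.1 j.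
  by move=> jJ; rewrite -scaleE /x /= !ffunE jJ subrr subr0 addr0.
have xhigh (j : 'I_J.+1) : j != J %[mod 2] -> x.1.2 j = (1 + t) *: h.2 j.
  by move=> /negPf jJ; rewrite -scaleE /x /= !ffunE jJ subrr subr0 addr0.
rewrite /obj2 xf mulrDr !mulr_sumr; congr (_ + _); apply: eq_bigr => j jJ.
  by rewrite xlow // circ_convZ -scalerBr normrZ exprMn real_normK ?num_real.
by rewrite xhigh // circ_convZ -scalerBr normrZ exprMn real_normK ?num_real.
Qed.

Lemma analytic_signalsZ (c : R) (f : sig) :
  analytic_signals f -> analytic_signals (c *: f).
Proof.
move=> fA k kN; have := fA k kN; rewrite !ffunE => fk.
under eq_bigr => m _ do rewrite ffunE -scalerAl.
by rewrite -scaler_sumr fk scaler0.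
Qed.

Lemma critical_point_obj2_eq0 (f_rec f : sig) (h : tuples) :
  critical_point (@obj2 R n p1 p2 a J)
    (C1 p1 p2 a f_rec `*` @analytic_signals R n) (h, f) ->
  obj2 p1 p2 a (h, f) = 0.
Proof.
pose u := (gamma_part h, f); pose w : tuples * sig := (h - gamma_part h, 0).
have uw : (h, f) = u + w by congr (_, _); rewrite ?addr0 //= addrC subrK.
move=> crit; have [[hC fA] _ _] := crit; rewrite uw in crit *.
apply: critical_point_quadratic crit _ _ => t; last by rewrite obj2_scale -uw.
move=> t1; split => /=; first by apply: C1_scale => //; rewrite gt_eqF //; lra.
by rewrite scaler0 addr0; exact: analytic_signalsZ.
Qed.

Lemma obj2_eq0_low (h : tuples) (f : sig) (j : 'I_J.+1) :
  obj2 p1 p2 a (h, f) = 0 -> j == J %[mod 2] ->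
  circ_conv f (psi_low n p1 p2 a j) = h.1 j.
Proof.
have nn (P : pred 'I_J.+1) (F : 'I_J.+1 -> sig) : 0 <= \sum_(i | P i) `|F i| ^+ 2.
  by apply: sumr_ge0 => i _; exact: sqr_ge0.
move=> /eqP; rewrite /obj2 paddr_eq0 // => /andP[+ _] jJ.
rewrite psumr_eq0 => [|i _]; last exact: sqr_ge0.
move=> /allP /(_ j (mem_index_enum j)); rewrite jJ /= sqrf_eq0 normr_eq0 subr_eq0.
by move/eqP.
Qed.

End Objective.

(** * Elimination of [gamma] between the scales [J] and [J - 2] *)

Theorem mainTheorem3 (R : realType) (n J : nat) (p1 p2 a : R)
  (p1_gt0 : 0 < p1) (p2_gt0 : 0 < p2) (a_gt1 : 1 < a) (J_ge2 : (2 <= J)%N)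
  (f_rec : signal R n) (f_rec_analytic : analytic_signals f_rec)
  (low_neq0 : forall (j : 'I_J.+1) (k : 'I_n.+1),
     circ_conv f_rec (psi_low n p1 p2 a j) k != 0)
  (high_neq0 : forall (j : 'I_J.+1) (k : 'I_n.+1),
     circ_conv f_rec (psi_high n p1 p2 a j) k != 0)
  (h : {ffun 'I_J.+1 -> signal R n} * {ffun 'I_J.+1 -> signal R n})
  (f : signal R n)
  (crit : critical_point (@obj2 R n p1 p2 a J)
     (C1 p1 p2 a f_rec `*` @analytic_signals R n) (h, f)) :
  exists alpha b : Rcomplex R,
    alpha != 0 /\ forall k : 'I_n.+1, f k = alpha * f_rec k + b.
Proof.
have a0 : 0 < a := lt_trans ltr01 a_gt1.
have [[[gamma [gamma0 hg]] fA] _ _] := crit.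
have obj0 := critical_point_obj2_eq0 crit.
have low_gamma (j : 'I_J.+1) k : j == J %[mod 2] ->
    circ_conv f (psi_low n p1 p2 a j) k =
    gamma k * circ_conv f_rec (psi_low n p1 p2 a j) k.
  by move=> jJ; have := hg j k; rewrite jJ (obj2_eq0_low obj0 jJ) => -[].
have iJ : (J - 2 < J.+1)%N by rewrite ltnS leq_subr.
pose j1 : 'I_J.+1 := ord_max; pose j2 := Ordinal iJ.
have j1J : j1 == J %[mod 2] by [].
have j2J : j2 == J %[mod 2] by rewrite /= -[X in _ == X %[mod 2]](subnK J_ge2) modnDr.
pose P := cauchy_poly p1 f; pose Q := cauchy_poly p1 f_rec.
pose s : Rcomplex R := (low_decay p2 a j1)%:C%C.
pose t : Rcomplex R := (low_decay p2 a j2)%:C%C.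
pose z (m : 'I_n.+1) : Rcomplex R := expi (2 * pi * m%:R / n.+1%:R).
have PQ (j : 'I_J.+1) m : j == J %[mod 2] ->
    P.[(low_decay p2 a j)%:C%C * z m] = gamma m * Q.[(low_decay p2 a j)%:C%C * z m].
  move=> jJ; have := low_gamma j m jJ; rewrite !circ_conv_psi_low // mulrCA.
  apply: mulfI; rewrite mulf_neq0 // ?invr_eq0 ?(pnatr_eq0 R[i]) //.
  by rewrite (fmorph_eq0 (@real_complex R)) gt_eqF // powR_gt0 // exprn_gt0.
have Q0 : Q != 0.
  apply: contraNneq (low_neq0 j1 ord0) => Q0.
  by rewrite circ_conv_psi_low // -/Q Q0 horner0 mulr0.
have [alpha PE] : exists alpha, P = alpha *: Q.
  have C0 (x : R) : 0 < x -> (x%:C%C : Rcomplex R) != 0.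
    by move=> x0; rewrite (fmorph_eq0 (@real_complex R)) gt_eqF.
  have st : low_decay p2 a j1 < low_decay p2 a j2.
    by apply: low_decay_decreasing => //=; rewrite ltn_subrL /= (ltnW J_ge2).
  apply: (@poly_dilation_rigidity_sampled _ s t [seq z m | m <- enum 'I_n.+1]).
  - by apply: C0; exact: low_decay_gt0.
  - by apply: C0; exact: low_decay_gt0.
  - move=> i j; rewrite /s /t -!(rmorphXn (@real_complex R)) -!(rmorphM (@real_complex R)).
    move/(fmorph_inj (@real_complex R)); apply: exprM_swap_inj => //.
    exact: low_decay_gt0.
  - by rewrite map_inj_uniq ?enum_uniq //; exact: expi_2pi_inj.
  - by apply/negP => /mapP[m _ /esym/eqP]; rewrite (negPf (expi_neq0 _)).
  - by apply: cauchy_poly_coef0; rewrite gt_eqF.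
  - by apply: cauchy_poly_coef0; rewrite gt_eqF.
  - exact: Q0.
  - rewrite size_map size_enum_ord.
    have sP := size_cauchy_poly p1 fA; have sQ := size_cauchy_poly p1 f_rec_analytic.
    apply: (@leq_trans (n.+1./2 + n.+1./2)).
      by apply: leq_add; rewrite -subn1 leq_subLR add1n.
    rewrite addnn -[X in (_ <= X)%N](odd_double_half n.+1).
    exact: leq_addl.
  (* The same [gamma m] serves both scales: each side is [gamma m] times the product of the two
     values of [Q]. *)
  - by move=> _ /mapP[m _ ->]; rewrite !PQ // mulrAC.
have [b fE] := eq_cauchy_poly PE.
exists alpha, b; split=> //.
(* If [alpha] were 0, [P] would vanish, and with it the convolution of [f] at scale [J], which is
   [gamma] times a nonzero entry. *)
apply: contraNneq (mulf_neq0 (gamma0 ord0) (low_neq0 j1 ord0)) => alpha0.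
by rewrite -low_gamma // circ_conv_psi_low // -/P PE alpha0 scale0r horner0 mulr0.
Qed.
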